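(* Let $N^{+}(s)$ and $N^{-}(s)$ be the numbers of eigenvalues, counted with multiplicity, in $(0,s]$ and in $[-s,0)$ respectively, of the modified wave operator $\Box'=-\frac{\partial^2}{\partial t^2}+\frac{\partial^2}{\partial x^2}+i\frac{\partial}{\partial x}$ on $S^1\times S^1$; that is, $$N^{+}(s)=\#\{(j,k)\in\mathbb{Z}^2:\ 0<j^2-k(k+1)\le s\},\qquad N^{-}(s)=\#\{(j,k)\in\mathbb{Z}^2:\ 0<k(k+1)-j^2\le s\}.$$ Then both $N^{+}(s)$ and $N^{-}(s)$ satisfy $$N^{\pm}(s)=s\log s+(4\log 2+2\gamma-1)s+R_{N^{\pm}}(s),\qquad R_{N^{\pm}}(s)=O(\sqrt{s})\quad\text{as } s\to\infty,$$ where $\gamma$ denotes Euler's constant.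
   Context: $S^1=\mathbb{R}/2\pi\mathbb{Z}$. The eigenfunctions of $\Box'$ are $e^{ijt}e^{ikx}$, $j,k\in\mathbb{Z}$, with eigenvalue $j^2-k(k+1)$. *)

(* Defs.v *)
From mathcomp Require Import all_boot all_order all_algebra finmap.
From mathcomp Require Import complex.
From mathcomp Require Import all_classical all_reals all_analysis.
Import Order.TTheory GRing.Theory Num.Theory numFieldNormedType.Exports.

Set Implicit Arguments.
Unset Strict Implicit.
Unset Printing Implicit Defensive.

Local Open Scope classical_set_scope.
Local Open Scope ring_scope.
Local Open Scope complex_scope.

(* [R[i]] is not a normed module over [R], so functions of a real variable
   with complex values are differentiated componentwise. *)
Definition cderivable (R : realType) (f : R -> R[i]) : Prop :=
  forall x : R, derivable (fun y => complex.Re (f y)) x 1 /\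
                derivable (fun y => complex.Im (f y)) x 1.

Definition cderive (R : realType) (f : R -> R[i]) : R -> R[i] :=
  fun x => derive1 (fun y => complex.Re (f y)) x +i*
           derive1 (fun y => complex.Im (f y)) x.

(* Functions of (t, x) on S^1 x S^1, with S^1 = R / 2 pi Z, are functions on
   R x R that are 2 pi-periodic in each variable. *)
Definition on_torus (R : realType) (u : R -> R -> R[i]) : Prop :=
  forall t x : R, u (t + 2 * pi) x = u t x /\ u t (x + 2 * pi) = u t x.

Definition dt (R : realType) (u : R -> R -> R[i]) : R -> R -> R[i] :=
  fun t x => cderive (fun t' => u t' x) t.

Definition dx (R : realType) (u : R -> R -> R[i]) : R -> R -> R[i] :=
  fun t x => cderive (u t) x.

Definition box' (R : realType) (u : R -> R -> R[i]) : R -> R -> R[i] :=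
  fun t x => - dt (dt u) t x + dx (dx u) t x + (0 +i* 1) * dx u t x.

(* [derive1] is a total operator with a default value where the derivative does not
   exist; this says that every derivative occurring in [box' u] exists. *)
Definition box'_dom (R : realType) (u : R -> R -> R[i]) : Prop :=
  [/\ forall x, cderivable (fun t => u t x),
      forall x, cderivable (fun t => dt u t x),
      forall t, cderivable (u t) &
      forall t, cderivable (dx u t)].

Definition eigenfunction (R : realType) (lambda : R) (u : R -> R -> R[i]) : Prop :=
  [/\ on_torus u, box'_dom u, (exists t x, u t x != 0) &
      forall t x, box' u t x = lambda%:C * u t x].

Definition expi (R : realType) (theta : R) : R[i] := cos theta +i* sin theta.

(* e^{ijt} e^{ikx} *)
Definition efun (R : realType) (j k : int) : R -> R -> R[i] :=
  fun t x => expi (j%:~R * t) * expi (k%:~R * x).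

(* The functions [efun j k], j, k in Z, form a complete orthogonal system in
   L^2(S^1 x S^1), so counting eigenvalues in I with multiplicity is counting
   the pairs (j, k) for which the eigenvalue of [efun j k] lies in I. *)
Definition eigen_index (R : realType) (I : set R) : set (int * int) :=
  [set p | exists2 lambda : R, I lambda & eigenfunction lambda (efun p.1 p.2)].

(* [fset_set A] is empty when A is infinite; the two counts below are
   meaningful because the index sets concerned are finite. *)
Definition eigen_count (R : realType) (I : set R) : nat :=
  #|` fset_set (eigen_index I) |%fset.

Definition Nplus (R : realType) (s : R) : nat :=
  eigen_count [set lambda : R | 0 < lambda <= s].

Definition Nminus (R : realType) (s : R) : nat :=
  eigen_count [set lambda : R | - s <= lambda < 0].

Definition euler_gamma (R : realType) : R :=
  limn (fun n : nat => \sum_(1 <= k < n.+1) k%:R^-1 - ln n%:R : R).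

(* Lets the Landau notation [f =O_+oo g] be used at plus infinity. *)
Canonical pinfty_filter_on (R : realType) : filter_on R :=
  FilterType (pinfty_nbhs R) _.

(* Main.v *)
Require Import Defs.
From mathcomp Require Import all_boot all_order all_algebra finmap.
From mathcomp Require Import complex.
From mathcomp Require Import all_classical all_reals all_analysis.
From mathcomp Require Import zify ring lra.
Import Order.TTheory GRing.Theory Num.Theory numFieldNormedType.Exports.

(** The function [efun j k] is an eigenfunction for exactly one eigenvalue,
    [symbol (j, k) = j ^ 2 - k * (k + 1)] ([eigenfunction_efun]), so both counts
    are counts of integer points. With [x = 2 * j - 2 * k - 1] and
    [y = 2 * j + 2 * k + 1] one has [x * y = 4 * symbol (j, k) - 1]
    ([symbol_factor]); here [x] and [y] are odd and [x + y] is a multiple of 4.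
    Hence the points with [0 < symbol <= s] come, two for each because of the
    symmetry [(x, y) -> (- x, - y)], from the factorizations [a * b] in positive
    integers of the numbers congruent to 3 modulo 4 up to [4 * s], and those with
    [- s <= symbol < 0] from the factorizations of the numbers [> 1] congruent to 1
    modulo 4 up to [4 * s + 1] ([symbol_set_count]). It remains to sum the divisor
    function over an odd residue class modulo 4.

    This is done by Dirichlet's hyperbola method ([lattice_count_hyperbola]). For
    odd [a] the condition on [a * b] modulo 4 selects one residue class of [b], so
    up to [O(K)], where [K] is about [sqrt M], the number of factorizations of
    the numbers up to [M] in the class is
    [2 * sum_(a <= K, a odd) M / (4 * a) - K ^ 2 / 8]
    ([lattice_count_asymptotics]). The odd harmonic sum equals
    [(ln K + ln 2 + gamma) / 2 + O(1 / K)] ([odd_harmonic_sum_bounds]), and taking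
    [M = 4 * s + O(1)] and [K = 2 * sqrt s + O(1)] produces
    [s * ln s + (4 * ln 2 + 2 * gamma - 1) * s + O(sqrt s)]
    ([factor_pairs_asymptotics]). *)

Set Implicit Arguments.
Unset Strict Implicit.
Unset Printing Implicit Defensive.

(** * Points under a hyperbola in a residue class modulo 4 *)

Definition under_hyperbola (r M : nat) (a b : nat) : bool :=
  (a * b <= M)%N && (a * b == r %[mod 4]).

Definition lattice_count (r M : nat) : nat :=
  \sum_(1 <= a < M.+1) \sum_(1 <= b < M.+1) under_hyperbola r M a b.

(** Dirichlet's hyperbola method: as [M < K.+1 ^ 2], a pair under the hyperbola
    has [a <= K] or [b <= K], and as [K ^ 2 <= M] the pairs with both are exactly
    those of the square of side [K]. The two strips have the same size because
    the condition is symmetric in [a] and [b]. *)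
Lemma lattice_count_hyperbola (r M K : nat) :
  (K * K <= M < K.+1 * K.+1)%N ->
  (lattice_count r M +
     \sum_(1 <= a < K.+1) \sum_(1 <= b < K.+1) (a * b == r %[mod 4]) =
   (\sum_(1 <= a < K.+1) \sum_(1 <= b < M.+1) under_hyperbola r M a b) * 2)%N.
Proof.
move=> /andP[K1 K2].
have KM : (K <= M)%N.
  by apply: leq_trans K1; case: (K) => // k; rewrite leq_pmull.
have restrict (F : nat -> nat) :
    (\sum_(1 <= a < K.+1) F a = \sum_(1 <= a < M.+1) (a <= K) * F a)%N.
  rewrite (big_nat_widen _ _ M.+1)//= big_mkcond/=; apply: eq_bigr => a _.
  by rewrite ltnS; case: (a <= K)%N; rewrite ?mul1n ?mul0n.
set A := (\sum_(1 <= a < K.+1) _ in RHS).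
have A1 : A = (\sum_(1 <= a < M.+1) \sum_(1 <= b < M.+1)
                 (a <= K) * under_hyperbola r M a b)%N.
  by rewrite /A restrict; apply: eq_bigr => a _; rewrite big_distrr.
have A2 : A = (\sum_(1 <= a < M.+1) \sum_(1 <= b < M.+1)
                 (b <= K) * under_hyperbola r M a b)%N.
  rewrite A1 exchange_big; apply: eq_bigr => a _; apply: eq_bigr => b _.
  by rewrite /under_hyperbola (mulnC a b).
rewrite muln2 -addnn {1}A1 A2 restrict -!big_split; apply: eq_bigr => a _ /=.
rewrite restrict big_distrr/= -!big_split/=; apply: eq_bigr => b _.
rewrite /under_hyperbola.
case: (leqP a K) => aK; case: (leqP b K) => bK;
  rewrite /= ?mul1n ?mul0n ?addn0 ?add0n//.
- by rewrite (leq_trans (leq_mul aK bK) K1).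
- by rewrite leqNgt (leq_trans K2 (leq_mul aK bK)).
Qed.

(** Every odd [a] is its own inverse modulo 4, so the congruence places [b] in the
    single class of [a * r], which occurs once in every four consecutive
    integers. *)
Lemma count_residue_class (a r Y : nat) : odd a -> odd r ->
  let c := (\sum_(1 <= b < Y.+1) (a * b == r %[mod 4]))%N in
  (4 * c <= Y + 3 /\ Y <= 4 * c + 3)%N.
Proof.
move=> oa or.
pose t := ((a * r) %% 4)%N.
have E b : (a * b == r %[mod 4]) = (b %% 4 == t)%N.
  rewrite /t -(modnMm a b) -(modnMm a r) -[in LHS](modn_mod r).
  have : odd (a %% 4) by rewrite odd_mod.
  have : odd (r %% 4) by rewrite odd_mod.
  have := ltn_pmod a (isT : (0 < 4)%N); have := ltn_pmod r (isT : (0 < 4)%N).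
  have := ltn_pmod b (isT : (0 < 4)%N).
  by case: (a %% 4)%N => [|[|[|[|[]]]]]//; case: (r %% 4)%N => [|[|[|[|[]]]]]//;
     case: (b %% 4)%N => [|[|[|[|[]]]]].
have t0 : odd t by rewrite /t odd_mod// oddM oa or.
have t4 : (t < 4)%N by rewrite /t ltn_pmod.
suff -> : (\sum_(1 <= b < Y.+1) (a * b == r %[mod 4]) = (Y + 4 - t) %/ 4)%N.
  by split; lia.
elim: Y => [|Y IH]; first by rewrite big_geq// divn_small//; lia.
rewrite big_nat_recr//= IH E; case: eqP; lia.
Qed.

Lemma count_residue_class_even (a r Y : nat) : ~~ odd a -> odd r ->
  (\sum_(1 <= b < Y.+1) (a * b == r %[mod 4]) = 0)%N.
Proof.
move=> ea or; rewrite big1// => b _; apply/eqP; rewrite eqb0; apply/eqP.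
by move=> /(congr1 odd); rewrite !odd_mod// or oddM (negbTE ea).
Qed.

Lemma sum_under_hyperbola (r M a : nat) : (0 < a <= M)%N ->
  (\sum_(1 <= b < M.+1) under_hyperbola r M a b =
   \sum_(1 <= b < (M %/ a).+1) (a * b == r %[mod 4]))%N.
Proof.
move=> /andP[a0 aM].
rewrite [RHS](big_nat_widen _ _ M.+1)/=; last by rewrite ltnS leq_div.
rewrite [RHS]big_mkcond/=; apply: eq_bigr => b _.
rewrite /under_hyperbola ltnS leq_divRL// mulnC.
by case: leqP.
Qed.

Lemma odd_count (K : nat) : (\sum_(1 <= a < K.+1) odd a = K.+1./2)%N.
Proof.
elim: K => [|K IH]; first by rewrite big_geq.
by rewrite big_nat_recr// IH /=; lia.
Qed.

Local Open Scope classical_set_scope.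
Local Open Scope ring_scope.

(** * Harmonic sums and Euler's constant *)

(** This is [ln (1 + z) <= z] at [z = (y - x) / x]; exchanging [x] and [y] gives
    the lower bound. *)
Lemma lnB_le (R : realType) (x y : R) :
  0 < x -> 0 < y -> ln y - ln x <= (y - x) / x.
Proof.
move=> x0 y0; rewrite -ln_div ?posrE//.
have -> : y / x = 1 + (y - x) / x by field; rewrite gt_eqF.
apply: le_ln1Dx; rewrite -subr_gt0.
have -> : (y - x) / x - -1 = y / x by field; rewrite gt_eqF.
exact: divr_gt0.
Qed.

Definition harmonic_sum (R : realType) (n : nat) : R :=
  \sum_(1 <= k < n.+1) (k%:R : R)^-1.

Lemma harmonic_sumS (R : realType) (n : nat) :
  harmonic_sum R n.+1 = harmonic_sum R n + (n.+1%:R : R)^-1.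
Proof. by rewrite /harmonic_sum big_nat_recr. Qed.

Lemma ln_succ_bounds (R : realType) (n : nat) :
  (n.+2%:R : R)^-1 <= ln (n.+2%:R : R) - ln (n.+1%:R : R) <= (n.+1%:R : R)^-1.
Proof.
rewrite -(natr1 n.+1).
have: 0 < (n.+1%:R : R) by rewrite ltr0n.
move: (n.+1%:R : R) => x x0.
have x1 : 0 < x + 1 by lra.
have := @lnB_le R _ _ x0 x1; have := @lnB_le R _ _ x1 x0.
have -> : x + 1 - x = 1 by ring.
have -> : x - (x + 1) = -1 by ring.
by rewrite mulN1r div1r => ? ?; apply/andP; split; lra.
Qed.

(** The sequence [u n = H n - ln n] decreases and [v n = u n - 1 / n] increases,
    both by [ln_succ_bounds], so the limit lies between them. *)
Lemma euler_gamma_bounds (R : realType) (n : nat) :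
  0 <= harmonic_sum R n.+1 - ln (n.+1%:R : R) - euler_gamma R
    <= (n.+1%:R : R)^-1.
Proof.
(* Both sequences are shifted by one, since [ln 0 = 0] breaks monotonicity. *)
pose u n : R := harmonic_sum R n.+1 - ln (n.+1%:R : R).
pose v n : R := u n - (n.+1%:R : R)^-1.
have uS m : u m.+1 <= u m.
  rewrite /u (harmonic_sumS R m.+1); have /andP[] := ln_succ_bounds R m.
  move: (m.+2%:R : R) (m.+1%:R : R) => x y ? ?; lra.
have vS m : v m <= v m.+1.
  rewrite /v /u (harmonic_sumS R m.+1); have /andP[] := ln_succ_bounds R m.
  move: (m.+2%:R : R) (m.+1%:R : R) => x y ? ?; lra.
have ui : {homo u : n m / (n <= m)%N >-> m <= n}.
  by apply: homo_leq => // x y z xy yz; exact: le_trans yz xy.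
have vi : {homo v : n m / (n <= m)%N >-> n <= m}.
  by apply: homo_leq => //; exact: le_trans.
have vu m : v m <= u m by rewrite /v gerBl invr_ge0 ler0n.
have vu' m m' : v m <= u m'.
  apply: le_trans (vi _ _ (leq_maxl m m')) _.
  exact: le_trans (vu _) (ui _ _ (leq_maxr m m')).
have cu : cvgn u.
  by apply: nonincreasing_is_cvgn => //; exists (v 0%N) => _ [m _ <-].
have cv : cvgn v.
  by apply: nondecreasing_is_cvgn => //; exists (u 0%N) => _ [m _ <-].
have E : euler_gamma R = limn u.
  rewrite /euler_gamma; apply/cvg_lim => //.
  by rewrite -(cvg_shiftS _); exact: cu.
have h1 : limn u <= u n by exact: nonincreasing_cvgn_ge.
have h2 : v n <= limn u.
  by apply: limr_ge => //; near=> m.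
move: h1 h2; rewrite E /v /u; move: (n.+1%:R : R) => x h1 h2.
by apply/andP; split; lra.
Unshelve. all: by end_near. Qed.

Definition odd_harmonic_sum (R : realType) (n : nat) : R :=
  \sum_(1 <= k < n.+1 | odd k) (k%:R : R)^-1.

Lemma odd_harmonic_sumE (R : realType) (n : nat) :
  odd_harmonic_sum R n = harmonic_sum R n - harmonic_sum R n./2 / 2.
Proof.
elim: n => [|n IH].
  by rewrite /odd_harmonic_sum /harmonic_sum !big_geq// mul0r subr0.
rewrite /odd_harmonic_sum big_mkcond big_nat_recr//= -big_mkcond/=.
rewrite -/(odd_harmonic_sum R n) IH uphalf_half harmonic_sumS.
case: (boolP (odd n)) => on /=; rewrite ?add1n ?add0n.
- rewrite harmonic_sumS addr0.
  (* [n.+1] is even, and its term is half of the new term of the second sum. *)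
  have -> : n.+1 = (n./2.+1 * 2)%N by have := odd_double_half n; lia.
  have h : (n./2.+1%:R : R) != 0 by rewrite pnatr_eq0.
  by rewrite natrM; field.
- ring.
Qed.

(** Removing the even terms leaves [H n - H (n / 2) / 2], that is
    [(ln n + gamma) - (ln n - ln 2 + gamma) / 2] up to [O(1 / n)]. *)
Lemma odd_harmonic_sum_bounds (R : realType) (n : nat) : (2 <= n)%N ->
  `|odd_harmonic_sum R n - (ln (n%:R : R) + ln 2 + euler_gamma R) / 2|
     <= 4 / (n%:R : R).
Proof.
move=> n2; rewrite odd_harmonic_sumE.
have := euler_gamma_bounds R n.-1; rewrite (@prednK n); last by lia.
have := euler_gamma_bounds R n./2.-1; rewrite (@prednK n./2); last by lia.
set h := n./2.
have h0 : 0 < (h%:R : R) by rewrite ltr0n /h; lia.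
have n0 : 0 < (n%:R : R) by rewrite ltr0n; lia.
have nh1 : (h%:R : R) * 2 <= (n%:R : R) by rewrite -natrM ler_nat /h; lia.
have nh2 : (n%:R : R) <= (h%:R : R) * 2 + 1.
  by rewrite -natrM natr1 ler_nat /h; lia.
have nh3 : (n%:R : R) <= (h%:R : R) * 3 by rewrite -natrM ler_nat /h; lia.
have l2 : ln ((h%:R : R) * 2) = ln (h%:R : R) + ln 2.
  by rewrite lnM ?posrE.
have h20 : 0 < (h%:R : R) * 2 by lra.
have L1 : 0 <= ln (n%:R : R) - ln ((h%:R : R) * 2) :> R.
  by rewrite subr_ge0 ler_ln ?posrE.
have L2 : ln (n%:R : R) - ln ((h%:R : R) * 2) <= (h%:R : R)^-1 / 2 :> R.
  apply: le_trans (@lnB_le R _ _ h20 n0) _.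
  rewrite -invfM -[leRHS]mul1r ler_pM2r ?invr_gt0//; lra.
have I3 : (h%:R : R)^-1 <= 3 / (n%:R : R).
  by rewrite ler_pdivlMr// mulrC ler_pdivrMr// mulrC.
have -> : 4 / (n%:R : R) = (n%:R : R)^-1 + 3 / (n%:R : R) by ring.
have nV : 0 < (n%:R : R)^-1 by rewrite invr_gt0.
move=> /andP[A1 A2] /andP[B1 B2]; rewrite ler_norml; apply/andP; split; lra.
Qed.

(** * Asymptotics of the number of points *)

Lemma ler_norm_sum_nat (R : realType) (F : nat -> R) (K : nat) :
  (forall a, (0 < a <= K)%N -> `|F a| <= 1) ->
  `|\sum_(1 <= a < K.+1) F a| <= (K%:R : R).
Proof.
move=> FK; apply: le_trans (ler_norm_sum _ _ _) _.
have -> : (K%:R : R) = \sum_(1 <= a < K.+1) 1.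
  by rewrite sumr_const_nat subn1.
by rewrite big_nat_cond [leRHS]big_nat_cond; apply: ler_sum => a /andP[/FK].
Qed.

(** For odd [a] the row above [a] holds [M / (4 * a)] points up to an error 1, and
    for even [a] it is empty. *)
Lemma strip_count_bound (R : realType) (r M K : nat) : odd r -> (K <= M)%N ->
  `|(\sum_(1 <= a < K.+1) \sum_(1 <= b < M.+1) under_hyperbola r M a b)%N%:R
     - (M%:R : R) / 4 * odd_harmonic_sum R K| <= (K%:R : R).
Proof.
move=> or KM; rewrite natr_sum /odd_harmonic_sum big_distrr/=.
rewrite [X in _ - X]big_mkcond/= -sumrB.
apply: ler_norm_sum_nat => a /andP[a0 aK].
have aM : (0 < a <= M)%N by rewrite a0 (leq_trans aK KM).
rewrite sum_under_hyperbola//.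
case: ifPn => [oa|ea]; last first.
  by rewrite count_residue_class_even// subr0 normr0.
have [] := @count_residue_class a r (M %/ a) oa or.
move: (\sum_(_ <= b < _) _)%N => c; set q := (M %/ a)%N => c1 c2.
have x0 : 0 < (a%:R : R) by rewrite ltr0n.
have q1 : (q%:R : R) <= (M%:R : R) / a%:R.
  by rewrite ler_pdivlMr// -natrM ler_nat /q leq_trunc_div.
have q2 : (M%:R : R) / a%:R <= (q%:R : R) + 1.
  by rewrite ler_pdivrMr// natr1 -natrM ler_nat ltnW// /q ltn_ceil.
have {}c1 : 4 * (c%:R : R) <= (q%:R : R) + 3 by rewrite -natrM -natrD ler_nat.
have {}c2 : (q%:R : R) <= 4 * (c%:R : R) + 3 by rewrite -natrM -natrD ler_nat.
rewrite mulrAC; move: ((M%:R : R) / a%:R) (q%:R : R) (c%:R : R) q1 q2 c1 c2.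
by move=> x y z *; rewrite ler_norml; apply/andP; split; lra.
Qed.

Lemma square_count_bound (R : realType) (r K : nat) : odd r -> (2 <= K)%N ->
  `|(\sum_(1 <= a < K.+1) \sum_(1 <= b < K.+1) (a * b == r %[mod 4]))%N%:R
     - (K%:R : R) ^+ 2 / 8| <= 2 * (K%:R : R).
Proof.
move=> or K2.
set E := (\sum_(1 <= a < K.+1) _)%N.
have H1 : `|(E%:R : R) - (K%:R : R) / 4 * (K.+1./2%:R : R)| <= (K%:R : R).
  rewrite -odd_count !natr_sum big_distrr/= -sumrB.
  apply: ler_norm_sum_nat => a _; case: (boolP (odd a)) => [oa|ea]; last first.
    by rewrite count_residue_class_even// mulr0 subr0 normr0.
  have [] := @count_residue_class a r K oa or.
  move: (\sum_(_ <= b < _) _)%N => c c1 c2; rewrite mulr1.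
  have {}c1 : 4 * (c%:R : R) <= (K%:R : R) + 3 by rewrite -natrM -natrD ler_nat.
  have {}c2 : (K%:R : R) <= 4 * (c%:R : R) + 3 by rewrite -natrM -natrD ler_nat.
  move: (K%:R : R) (c%:R : R) c1 c2 => x y *.
  by rewrite ler_norml; apply/andP; split; lra.
have h1 : (K%:R : R) <= 2 * (K.+1./2%:R : R) by rewrite -natrM ler_nat; lia.
have h2 : 2 * (K.+1./2%:R : R) <= (K%:R : R) + 1.
  by rewrite -natrM natr1 ler_nat; lia.
have x0 : 0 <= (K%:R : R) by rewrite ler0n.
move: (K%:R : R) (K.+1./2%:R : R) (E%:R : R) H1 h1 h2 x0 => x h e.
rewrite !ler_norml => /andP[A1 A2] h1 h2 x0.
by apply/andP; split; nra.
Qed.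

(** In the hyperbola method twice the strip contributes
    [M / 2 * (1 + 1/3 + 1/5 + ...)], the sum running up to [K], and the square,
    which it counts once too often, [K ^ 2 / 8].
    The error [4 / K] of the odd harmonic sum is multiplied by [M <= 2 * K ^ 2],
    so every error is of the order of [K]. *)
Lemma lattice_count_asymptotics (R : realType) (r M K : nat) :
  odd r -> (2 <= K)%N -> (K * K <= M < K.+1 * K.+1)%N ->
  `|2 * ((lattice_count r M)%:R : R) -
    ((M%:R : R) / 2 * (ln (K%:R : R) + ln 2 + euler_gamma R)
     - (K%:R : R) ^+ 2 / 4)| <= 16 * (K%:R : R).
Proof.
move=> or K2 KM.
have := congr1 (fun n : nat => n%:R : R) (@lattice_count_hyperbola r M K KM).
have /andP[KM1 KM2] := KM.
have KM' : (K <= M)%N by apply: leq_trans KM1; rewrite leq_pmull//; lia.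
have M2 : (M <= 2 * (K * K))%N by nia.
have {}M2 : (M%:R : R) <= 2 * (K%:R : R) * (K%:R : R).
  by rewrite -!natrM ler_nat; lia.
have x2 : 2 <= (K%:R : R) by rewrite ler_nat.
have m0 : 0 <= (M%:R : R) by rewrite ler0n.
have := @strip_count_bound R r M K or KM'.
have := @square_count_bound R r K or K2.
have := @odd_harmonic_sum_bounds R K K2.
rewrite natrD natrM.
move: (\sum_(_ <= a < _) \sum_(_ <= b < M.+1) _)%N => A.
move: (\sum_(_ <= a < _) _)%N => E.
move: (A%:R : R) (E%:R : R) ((lattice_count r M)%:R : R) (odd_harmonic_sum R K).
move: (ln _ + ln 2 + _) => T A' E' D O.
move: (K%:R : R) (M%:R : R) x2 m0 M2 => x m x2 m0 M2 H1 H2 H3 H4.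
have {}H1 : `|m / 4 * O - m / 8 * T| <= 2 * x.
  have -> : m / 4 * O - m / 8 * T = m / 4 * (O - T / 2) by field.
  rewrite normrM ger0_norm; last by lra.
  apply: le_trans (_ : m / 4 * (4 / x) <= _); first by rewrite ler_wpM2l//; lra.
  have -> : m / 4 * (4 / x) = m / x by field; rewrite gt_eqF//; lra.
  by rewrite ler_pdivrMr//; lra.
move: H1 H2 H3; rewrite !ler_norml => /andP[? ?] /andP[? ?] /andP[? ?].
by apply/andP; split; lra.
Qed.

(** * Eigenvalues of the modified wave operator *)

Local Open Scope complex_scope.

(** The constant factor [c] makes the family of functions [c * expi (w * y)] stable
    under differentiation, which only multiplies [c] by [0 +i* w]. *)
Lemma is_derive_Re_expi (R : realType) (c : R[i]) (w x : R) :
  is_derive x (1 : R) (fun y => complex.Re (c * expi (w * y)))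
    (complex.Re (c * (0 +i* w) * expi (w * x))).
Proof.
by case: c => p q /=; apply: is_derive_eq; rewrite /GRing.scale/=; ring.
Qed.

Lemma is_derive_Im_expi (R : realType) (c : R[i]) (w x : R) :
  is_derive x (1 : R) (fun y => complex.Im (c * expi (w * y)))
    (complex.Im (c * (0 +i* w) * expi (w * x))).
Proof.
by case: c => p q /=; apply: is_derive_eq; rewrite /GRing.scale/=; ring.
Qed.

Lemma cderivable_expi (R : realType) (c : R[i]) (w : R) :
  cderivable (fun y => c * expi (w * y)).
Proof.
move=> x; split.
  by have [] := is_derive_Re_expi c w x.
by have [] := is_derive_Im_expi c w x.
Qed.

Lemma cderive_expi (R : realType) (c : R[i]) (w : R) :
  cderive (fun y => c * expi (w * y)) =
  fun x => c * (0 +i* w) * expi (w * x).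
Proof.
apply/funext => x; rewrite /cderive !derive1E.
rewrite (@derive_val _ _ _ _ _ _ _ (is_derive_Re_expi c w x)).
rewrite (@derive_val _ _ _ _ _ _ _ (is_derive_Im_expi c w x)).
by case: (_ * _).
Qed.

Lemma dt_efun (R : realType) (c : R[i]) (j k : int) :
  dt (fun t x => c * efun j k t x) =
  fun t x => c * (0 +i* j%:~R) * efun j k t x.
Proof.
apply/funext => t; apply/funext => x; rewrite /dt /efun.
under eq_fun do rewrite mulrCA mulrC.
under eq_fun do rewrite mulrC.
under eq_fun do rewrite mulrC.
rewrite cderive_expi; ring.
Qed.

Lemma dx_efun (R : realType) (c : R[i]) (j k : int) :
  dx (fun t x => c * efun j k t x) =
  fun t x => c * (0 +i* k%:~R) * efun j k t x.
Proof.
apply/funext => t; apply/funext => x; rewrite /dx /efun.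
under eq_fun do rewrite mulrA.
rewrite cderive_expi; ring.
Qed.

Lemma cderivable_efun_t (R : realType) (c : R[i]) (j k : int) (x : R) :
  cderivable (fun t => c * efun j k t x).
Proof.
rewrite /efun; under eq_fun do rewrite [expi _ * expi _]mulrC mulrA.
exact: cderivable_expi.
Qed.

Lemma cderivable_efun_x (R : realType) (c : R[i]) (j k : int) (t : R) :
  cderivable (fun x => c * efun j k t x).
Proof.
rewrite /efun; under eq_fun do rewrite mulrA.
exact: cderivable_expi.
Qed.

Lemma expi_int_period (R : realType) (m : int) (x : R) :
  expi (m%:~R * (x + 2 * pi)) = expi (m%:~R * x) :> R[i].
Proof.
have E (n : nat) y : expi (y + (pi *+ 2) *+ n) = expi y :> R[i].
  by rewrite /expi (periodicn (@cosD2pi R)) (periodicn (@sinD2pi R)).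
have pi2 n : 2 * pi * n%:R = (pi *+ 2) *+ n :> R.
  by rewrite mulr_natr mulr_natl.
rewrite mulrDr mulrC [_ * (2 * pi)]mulrC [x * _]mulrC.
case: m => n.
  by rewrite -[in 2 * pi * _]pmulrn pi2 E.
by rewrite -[LHS](E n.+1) NegzE rmorphN/= -[in 2 * pi * _]pmulrn mulrN pi2 subrK.
Qed.

Lemma expi_neq0 (R : realType) (x : R) : expi x != 0 :> R[i].
Proof.
apply/eqP => -[c0 s0]; have := cos2Dsin2 x.
by rewrite c0 s0 !expr0n addr0 => /eqP; rewrite eq_sym oner_eq0.
Qed.

(** The eigenvalue of [box'] on [efun p.1 p.2]. *)
Definition symbol (p : int * int) : int := p.1 ^+ 2 - p.2 * (p.2 + 1).

Lemma box'_efun (R : realType) (j k : int) (t x : R) :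
  box' (efun j k) t x = ((symbol (j, k))%:~R : R)%:C * efun j k t x.
Proof.
have E : efun j k = fun t x => 1 * efun j k t x :> R[i].
  by apply/funext => t'; apply/funext => x'; rewrite mul1r.
rewrite /box' {1 2 3}E !dt_efun !dx_efun !mul1r.
set e := efun j k t x.
transitivity ((- ((0 +i* j%:~R) * (0 +i* j%:~R)) +
  (0 +i* k%:~R) * (0 +i* k%:~R) + (0 +i* 1) * (0 +i* k%:~R)) * e); first by ring.
congr (_ * _); rewrite /symbol/= rmorphB/= rmorphXn/= rmorphM/= rmorphD/=.
by simpc; congr (_ +i* _); ring.
Qed.

(** Since [efun j k] does not vanish at the origin, it determines its eigenvalue. *)
Lemma eigenfunction_efun (R : realType) (lambda : R) (j k : int) :
  eigenfunction lambda (efun j k) <-> lambda = (symbol (j, k))%:~R.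
Proof.
split=> [[_ _ _ H]|->].
  have e0 : efun j k 0 0 != 0 :> R[i] by rewrite mulf_neq0 ?expi_neq0.
  by have := H 0 0; rewrite box'_efun => /(mulIf e0) [].
have E : efun j k = fun t x => 1 * efun j k t x :> R[i].
  by apply/funext => t'; apply/funext => x'; rewrite mul1r.
split.
- by move=> t x; rewrite /efun !expi_int_period.
- split=> [x|x|t|t]; rewrite E.
  + exact: cderivable_efun_t.
  + rewrite dt_efun; exact: cderivable_efun_t.
  + exact: cderivable_efun_x.
  + rewrite dx_efun; exact: cderivable_efun_x.
- by exists 0, 0; rewrite mulf_neq0 ?expi_neq0.
- exact: box'_efun.
Qed.

Lemma eigen_indexE (R : realType) (I : set R) :
  eigen_index I = [set p | I (symbol p)%:~R].
Proof.
apply/seteqP; split=> -[j k]/=.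
  by move=> [l Il /eigenfunction_efun <-].
by move=> Il; exists ((symbol (j, k))%:~R); last exact/eigenfunction_efun.
Qed.

Local Close Scope complex_scope.

(** * Eigenvalues as products of two factors *)

(** The pair (1, 1) is excluded because, when [r = 1], it corresponds to the
    eigenvalue 0. *)
Definition factor_pairs (r M : nat) : seq (nat * nat) :=
  [seq p <- [seq (a, b) | a <- iota 1 M, b <- iota 1 M] |
     (1 < p.1 * p.2)%N && under_hyperbola r M p.1 p.2].

Lemma mem_factor_pairs (r M a b : nat) :
  ((a, b) \in factor_pairs r M) = (1 < a * b <= M)%N && (a * b == r %[mod 4]).
Proof.
rewrite mem_filter /= /under_hyperbola andbA.
case: (boolP (1 < a * b <= M)%N) => //= /andP[ab1 abM].
have : (0 < a * b)%N by exact: ltnW.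
rewrite muln_gt0 => /andP[a0 b0].
have ha := leq_pmulr a b0; have hb := leq_pmull b a0.
by rewrite allpairs_f ?andbT// mem_iota; lia.
Qed.

Lemma uniq_factor_pairs (r M : nat) : uniq (factor_pairs r M).
Proof.
apply: filter_uniq; apply: allpairs_uniq; rewrite ?iota_uniq//.
by move=> [? ?] [? ?].
Qed.

(** The two counts differ at most by the pair (1, 1), which lies in the residue
    class only for [r = 1] modulo 4. *)
Lemma size_factor_pairs (r M : nat) :
  (size (factor_pairs r M) <= lattice_count r M <= (size (factor_pairs r M)).+1)%N.
Proof.
rewrite size_filter; set L := (X in count _ X).
have uL : uniq L.
  by apply: allpairs_uniq; rewrite ?iota_uniq// => -[? ?] [? ?].
pose dp (p : nat * nat) := under_hyperbola r M p.1 p.2.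
have -> : lattice_count r M = count dp L.
  rewrite /lattice_count -sum1_count [RHS]big_mkcond /L big_allpairs/=.
  rewrite /index_iota subn1; apply: eq_bigr => a _; apply: eq_bigr => b _.
  by rewrite /dp; case: under_hyperbola.
apply/andP; split; first by apply: sub_count => p /andP[].
set A := (fun p => _ && _).
have <- : (count A L + 1 = (count A L).+1)%N by rewrite addn1.
apply: (@leq_trans (count A L + count_mem (1, 1)%N L)); last first.
  by rewrite leq_add2l count_uniq_mem// leq_b1.
rewrite -count_predUI; apply: leq_trans (leq_addr _ _).
have -> : count dp L = count (predI (mem L) dp) L.
  by apply: eq_in_count => p /= ->.
apply: sub_count => -[a b] /= /andP[/allpairsP[[a' b'] [+ + [-> ->]]] /= d].
rewrite !mem_iota /A/= => /andP[a0 _] /andP[b0 _].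
rewrite [under_hyperbola _ _ _ _]d andbT xpair_eqE.
case: ltnP => //=.
rewrite leq_eqVlt ltnS leqn0 muln_eq0 (gtn_eqF a0) (gtn_eqF b0).
by rewrite /= orbF muln_eq1.
Qed.

(** The inverse of the change of variables [x = 2 * j - 2 * k - 1],
    [y = 2 * j + 2 * k + 1]. *)
Definition lattice_point (x y : int) : int * int :=
  (((x + y) %/ 4)%Z, ((y - x - 2) %/ 4)%Z).

Lemma lattice_pointK (j k : int) :
  lattice_point (2 * j - 2 * k - 1) (2 * j + 2 * k + 1) = (j, k).
Proof. by rewrite /lattice_point; congr pair; lia. Qed.

Lemma lattice_pointE (x y q w : int) : x + y = 4 * q -> x = 2 * w + 1 ->
  let p := lattice_point x y in
  x = 2 * p.1 - 2 * p.2 - 1 /\ y = 2 * p.1 + 2 * p.2 + 1.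
Proof. by rewrite /lattice_point/=; lia. Qed.

(** Completing the square in [j ^ 2 - k * (k + 1)] turns the quadratic form into a
    product. *)
Lemma symbol_factor (j k : int) :
  (2 * j - 2 * k - 1) * (2 * j + 2 * k + 1) = 4 * symbol (j, k) - 1.
Proof. by rewrite /symbol/=; ring. Qed.

(** The points [(j, k)] with [e * symbol (j, k) > 0], where [e] is a sign, are those
    for which [e * x * y > 0]: up to replacing [(x, y)] by [(- x, - y)], one has
    [x = e * a] and [y = b] with [a] and [b] positive. *)
Definition lattice_points (e : int) (r M : nat) : seq (int * int) :=
  [seq lattice_point (e * p.1%:Z) p.2%:Z | p <- factor_pairs r M] ++
  [seq lattice_point (- (e * p.1%:Z)) (- p.2%:Z) | p <- factor_pairs r M].

(** As [4 * (e * symbol) = a * b + e], the product [a * b] is [- e] modulo 4. *)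
Definition sign_class (e : int) (r : nat) : Prop :=
  (e = 1 /\ r = 3%N) \/ (e = -1 /\ r = 1%N).

(** The congruence on [a * b] already forces [a] to be odd and [e * a + b] to be a
    multiple of 4, which is what makes [lattice_point] exact. *)
Lemma factor_pairs_parity (e : int) (r M a b : nat) :
  sign_class e r -> (a, b) \in factor_pairs r M ->
  exists q w : int, e * a%:Z + b%:Z = 4 * q /\ e * a%:Z = 2 * w + 1.
Proof.
move=> er; rewrite mem_factor_pairs => /andP[_]; rewrite -(modnMm a b).
have := divn_eq a 4; have := divn_eq b 4.
have := ltn_pmod a (isT : (0 < 4)%N); have := ltn_pmod b (isT : (0 < 4)%N).
move: (a %/ 4)%N (b %/ 4)%N (a %% 4)%N (b %% 4)%N => a' b' a'' b'' + + -> ->.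
case: er => [[-> ->]|[-> ->]]; case: a'' => [|[|[|[|[]]]]]//;
  case: b'' => [|[|[|[|[]]]]]// _ _ _.
- by exists (a'%:Z + b'%:Z + 1), (2 * a'%:Z); split; lia.
- by exists (a'%:Z + b'%:Z + 1), (2 * a'%:Z + 1); split; lia.
- by exists (b'%:Z - a'%:Z), (- 2 * a'%:Z - 1); split; lia.
- by exists (b'%:Z - a'%:Z), (- 2 * a'%:Z - 2); split; lia.
Qed.

Lemma lattice_point_factor_pair (e : int) (r M a b : nat) :
  sign_class e r -> (a, b) \in factor_pairs r M ->
  (let p := lattice_point (e * a%:Z) b%:Z in
   e * a%:Z = 2 * p.1 - 2 * p.2 - 1 /\ b%:Z = 2 * p.1 + 2 * p.2 + 1) /\
  (let p := lattice_point (- (e * a%:Z)) (- b%:Z) in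
   - (e * a%:Z) = 2 * p.1 - 2 * p.2 - 1 /\ - b%:Z = 2 * p.1 + 2 * p.2 + 1).
Proof.
move=> er /(factor_pairs_parity er)[q [w [h1 h2]]].
split; first exact: lattice_pointE h1 h2.
by apply: (@lattice_pointE _ _ (- q) (- w - 1)); lia.
Qed.

Lemma uniq_lattice_points (e : int) (r M : nat) :
  sign_class e r -> uniq (lattice_points e r M).
Proof.
move=> er; have fP := @lattice_point_factor_pair e r M _ _ er.
rewrite cat_uniq; apply/and3P; split.
- rewrite map_inj_in_uniq ?uniq_factor_pairs// => -[a b] [a' b'].
  move=> /fP[[h1 h2] _] /fP[[h1' h2'] _] /= E.
  rewrite E in h1 h2; congr pair.
    by case: er => -[? _]; subst e; lia.
  by lia.
- apply/hasPn => _ /mapP[[a b] ab ->]; apply/negP => /mapP[[a' b'] ab' /= E].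
  have [_ [_ h]] := fP _ _ ab; have [[_ h'] _] := fP _ _ ab'.
  move: ab ab'; rewrite !mem_factor_pairs => /andP[/andP[ab _] _].
  rewrite E in h.
  have b0 : (0 < b)%N by move: ab; case: (b) => //; rewrite muln0.
  by move=> _; lia.
- rewrite map_inj_in_uniq ?uniq_factor_pairs// => -[a b] [a' b'].
  move=> /fP[_ [h1 h2]] /fP[_ [h1' h2']] /= E.
  rewrite E in h1 h2; congr pair.
    by case: er => -[? _]; subst e; lia.
  by lia.
Qed.

Lemma size_lattice_points (e : int) (r M : nat) :
  size (lattice_points e r M) = (2 * size (factor_pairs r M))%N.
Proof. by rewrite size_cat !size_map addnn mul2n. Qed.

Lemma factor_pair_of_symbol (e : int) (r n a b : nat) (t : int) :
  sign_class e r -> (a * b)%N%:Z + e = 4 * t -> 0 < t <= n%:Z ->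
  (a, b) \in factor_pairs r (4 * n + 1).
Proof.
move=> er; rewrite mem_factor_pairs; move: (a * b)%N => m h1 h2.
by case: er => -[? ?]; subst e r; apply/andP; split; lia.
Qed.

(** For either sign the bound [e * symbol <= n] becomes [a * b <= 4 * n - e], which
    amounts to [a * b <= 4 * n + 1] in the residue class of [a * b] modulo 4. *)
Lemma mem_lattice_points (e : int) (r n : nat) (p : int * int) :
  sign_class e r ->
  (p \in lattice_points e r (4 * n + 1)) = (0 < e * symbol p <= n%:Z).
Proof.
move=> er; case: p => j k; have e2 : e * e = 1 by case: er => -[-> _].
have S := symbol_factor j k.
apply/idP/idP => [|tn].
  rewrite mem_cat => H.
  have [a [b [ab E]]] : exists a b, (a, b) \in factor_pairs r (4 * n + 1) /\
      (e * a%:Z) * b%:Z = 4 * symbol (j, k) - 1.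
    case/orP: H => /mapP[[a b] ab /= E]; exists a, b; split=> //;
      have [[h1 h2] [h3 h4]] := lattice_point_factor_pair er ab.
      by rewrite -E in h1 h2; rewrite h1 h2 S.
    by rewrite -E in h3 h4; rewrite -mulrNN h3 h4 S.
  move: ab; rewrite mem_factor_pairs => /andP[h1 h2].
  move: h1 h2 E; rewrite -mulrA -PoszM; move: (a * b)%N (symbol _) => m t.
  by case: er => -[-> ->]; lia.
set x : int := 2 * j - 2 * k - 1 in S; set y : int := 2 * j + 2 * k + 1 in S.
have y0 : y <> 0 by rewrite /y; lia.
have h : (e * x) * y + e = 4 * (e * symbol (j, k)) by rewrite -mulrA S; ring.
have exy : 0 < (e * x) * y by case: er h tn => -[-> _]; lia.
have ab : (absz (e * x), absz y) \in factor_pairs r (4 * n + 1).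
  apply: factor_pair_of_symbol er _ tn.
  by rewrite -h -abszM; congr (_ + _); rewrite gez0_abs// ltW.
rewrite mem_cat; apply/orP.
have [yp|yn] : 0 < y \/ y < 0 by lia.
- left; apply/mapP; exists (absz (e * x), absz y) => //=.
  have ex : 0 < e * x by rewrite -(pmulr_lgt0 _ yp).
  by rewrite !gtz0_abs// mulrA e2 mul1r lattice_pointK.
- right; apply/mapP; exists (absz (e * x), absz y) => //=.
  have ex : e * x < 0 by rewrite -(nmulr_lgt0 _ yn).
  by rewrite !ltz0_abs// mulrN !opprK mulrA e2 mul1r lattice_pointK.
Qed.

Lemma int_le_truncn (R : realType) (s : R) (t : int) :
  (0 < (t%:~R : R) <= s) = (0 < t <= (Num.truncn s)%:Z).
Proof.
rewrite ltr0z; case: t => [[|m]|m] //=.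
by rewrite -[m.+1%:~R]/(m.+1%:R : R) -truncn_gt_nat.
Qed.

(** As [symbol] takes integer values, [s] may be replaced by its integer part [n];
    each factor pair then yields the two points [lattice_point (e * a) b] and
    [lattice_point (- (e * a)) (- b)]. *)
Lemma symbol_set_count (R : realType) (e : int) (r : nat) (s : R) :
  sign_class e r ->
  let L := [set p | 0 < ((e * symbol p)%:~R : R) <= s] in
  finite_set L /\ #|` fset_set L |%fset =
    (2 * size (factor_pairs r (4 * Num.truncn s + 1)))%N.
Proof.
move=> er L; set t := lattice_points e r (4 * Num.truncn s + 1).
have E : L = [set` t].
  by apply/seteqP; split=> p /=; rewrite /L/= int_le_truncn mem_lattice_points.
have fL : finite_set L by rewrite E; exact: finite_seq.
split=> //; rewrite -(size_lattice_points e) -/t.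
apply: perm_size; apply: uniq_perm; rewrite ?fset_uniq ?uniq_lattice_points//.
by move=> p; rewrite in_fset_set// E; apply/idP/idP => [/set_mem|/mem_set].
Qed.

(** * The asymptotic formula *)

(** With [q = sqrt s], one has [M = 4 * q ^ 2 + O(1)] and [K = 2 * q + O(1)] in
    [lattice_count_asymptotics]. Replacing [K] by [2 * q] there changes the result
    by [O(q)], and since [ln (2 * q) = ln 2 + ln s / 2] this gives
    [2 * s * (ln s / 2 + 2 * ln 2 + gamma) - s], the main term. *)
Lemma factor_pairs_asymptotics (R : realType) (r : nat) (s : R) :
  odd r -> 9 <= s ->
  `|(2 * size (factor_pairs r (4 * Num.truncn s + 1)))%N%:R -
    (s * ln s + (4 * ln 2 + 2 * euler_gamma R - 1) * s)| <= 200 * Num.sqrt s.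
Proof.
move=> or s9.
set n := Num.truncn s; set M := (4 * n + 1)%N.
have s0 : 0 <= s by lra.
have /andP[n1 n2] := truncn_itv s0; rewrite -/n in n1 n2.
have [K /andP[K1 K2]] : exists K, (K * K <= M < K.+1 * K.+1)%N.
  have ex0 : exists k, (k * k <= M)%N by exists 0%N.
  have bd k : (k * k <= M)%N -> (k <= M)%N.
    by apply: leq_trans; case: k => // k; rewrite leq_pmull.
  case: (ex_maxnP ex0 bd) => K KM Kmax; exists K; rewrite KM/= ltnNge.
  by apply/negP => /Kmax; rewrite ltnn.
set q : R := Num.sqrt s.
have qq : s = q ^+ 2 by rewrite sqr_sqrtr.
have q0 : 0 <= q by rewrite sqrtr_ge0.
(* This is where [9 <= s] enters: it keeps [K] and [q] away from 0, so that the
   quotients [1 / K] and [1 / q] below are harmless. *)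
have q3 : 3 <= q by rewrite qq in s9; nra.
have M1 : (M%:R : R) <= 4 * q ^+ 2 + 1.
  by rewrite -qq /M natrD natrM; lra.
have M2 : 4 * q ^+ 2 - 3 <= (M%:R : R).
  by rewrite -qq /M natrD natrM; move: n2; rewrite -natr1; lra.
have {}K1 : (K%:R : R) ^+ 2 <= (M%:R : R) by rewrite expr2 -natrM ler_nat.
have K2' : (M%:R : R) <= ((K%:R : R) + 1) ^+ 2.
  by rewrite natr1 expr2 -natrM ler_nat ltnW.
have k0 : 0 <= (K%:R : R) by rewrite ler0n.
have Kq1 : (K%:R : R) <= 2 * q + 1.
  move: (K%:R : R) k0 (K1 : _ <= _) M1 => k *; nra.
have Kq2 : 2 * q - 3 <= (K%:R : R).
  move: (K%:R : R) k0 K2' M2 => k *; nra.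
have K3 : 3 <= (K%:R : R) by lra.
have KK : (2 <= K)%N by rewrite -(ler_nat R); lra.
have KM : (K * K <= M < K.+1 * K.+1)%N.
  by rewrite K2 andbT -(ler_nat R) natrM -expr2.
have := @lattice_count_asymptotics R r M K or KK KM.
have /andP[S1 S2] := size_factor_pairs r M.
have {}S1 : ((size (factor_pairs r M))%:R : R) <= (lattice_count r M)%:R.
  by rewrite ler_nat.
have {}S2 : ((lattice_count r M)%:R : R) <= (size (factor_pairs r M))%:R + 1.
  by rewrite natr1 ler_nat.
have q20 : 0 < 2 * q by lra.
have K0 : 0 < (K%:R : R) by lra.
have l1 : ln (2 * q) = ln 2 + ln q by rewrite lnM ?posrE//; lra.
have -> : ln s = 2 * ln q by rewrite qq expr2 lnM ?posrE; lra.
have L1 : q * (ln (K%:R : R) - ln (2 * q)) <= 1.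
  have := @lnB_le R _ _ q20 K0; rewrite ler_pdivlMr//; lra.
have L2 : q * (ln (2 * q) - ln (K%:R : R)) <= 3.
  have := @lnB_le R _ _ K0 q20; rewrite ler_pdivlMr//.
  have [l|l] := leP (ln (2 * q) - ln (K%:R : R)) 0; last nra.
  by move=> _; apply: le_trans (_ : 0 <= _) => //; rewrite pmulr_rle0//; lra.
have l2 : 0 <= ln (2 : R) <= 1.
  by rewrite ln_ge0 ?ler1n//=; have := @le_ln1Dx R 1; lra.
have lK : 0 <= ln (K%:R : R) <= (K%:R : R).
  by rewrite ln_ge0 ?ltW ?ln_sublinear//; lra.
have g : 0 <= euler_gamma R <= 1.
  have := euler_gamma_bounds R 0; have := euler_gamma_bounds R 1.
  by rewrite !harmonic_sumS /harmonic_sum big_geq//= ln1 invr1; lra.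
rewrite qq natrM; move: L1 L2 S1 S2; rewrite l1.
move: ((size (factor_pairs r M))%:R : R) ((lattice_count r M)%:R : R) => S D.
move: (euler_gamma R) g (ln 2) l2 (ln q) (ln (K%:R : R)) lK => g g01 l2 l201.
move: (K%:R : R) (M%:R : R) K1 K2' Kq1 Kq2 K3 M1 M2 => k m _ _.
move=> k1 k2 k3 m1 m2 lq lk lk01 L1 L2 h1 h2.
move=> H; have {l201 g01 lk01} T : 0 <= lk + l2 + g <= k + 2 by lra.
(* The three replacements, in order: [M / 2] by [2 * q ^ 2], [ln K] by
   [ln (2 * q)], and [K ^ 2 / 4] by [q ^ 2]. *)
have E1 : `|(m / 2 - 2 * q ^+ 2) * (lk + l2 + g)| <= 3 / 2 * (k + 2).
  rewrite normrM; apply: ler_pM => //.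
    by rewrite ler_norml; apply/andP; split; lra.
  by rewrite ger0_norm; lra.
have E2 : `|2 * q ^+ 2 * (lk - (l2 + lq))| <= 6 * q.
  have -> : 2 * q ^+ 2 * (lk - (l2 + lq)) =
      2 * q * (q * (lk - (l2 + lq))) by ring.
  rewrite normrM ger0_norm; last by lra.
  have -> : 6 * q = 2 * q * 3 by ring.
  apply: ler_wpM2l; first by lra.
  by rewrite ler_norml; apply/andP; split; lra.
have E3 : `|k ^+ 2 / 4 - q ^+ 2| <= 3 * (4 * q + 1) / 4.
  have -> : k ^+ 2 / 4 - q ^+ 2 = (k - 2 * q) * (k + 2 * q) / 4 by field.
  rewrite normrM (@ger0_norm _ 4^-1) ?invr_ge0// ler_pM2r ?invr_gt0//.
  rewrite normrM; apply: ler_pM => //.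
    by rewrite ler_norml; apply/andP; split; lra.
  by rewrite ger0_norm; lra.
move: H E1 E2 E3; rewrite !ler_norml.
move=> /andP[? ?] /andP[? ?] /andP[? ?] /andP[? ?].
by apply/andP; split; lra.
Qed.

Unset Implicit Arguments.

Theorem mainTheorem4 (R : realType) :
  let Lplus (s : R) : set (int * int) :=
    [set p : int * int | (0 : R) < (p.1 ^+ 2 - p.2 * (p.2 + 1))%:~R <= s] in
  let Lminus (s : R) : set (int * int) :=
    [set p : int * int | (0 : R) < (p.2 * (p.2 + 1) - p.1 ^+ 2)%:~R <= s] in
  let main (s : R) : R :=
    s * ln s + (4 * ln 2 + 2 * euler_gamma R - 1) * s in
  [/\ forall s : R,
        [/\ finite_set (eigen_index [set lambda : R | 0 < lambda <= s]),
            finite_set (Lplus s) &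
            Nplus s = #|` fset_set (Lplus s) |%fset],
      forall s : R,
        [/\ finite_set (eigen_index [set lambda : R | - s <= lambda < 0]),
            finite_set (Lminus s) &
            Nminus s = #|` fset_set (Lminus s) |%fset],
      (fun s : R => (Nplus s)%:R - main s : R) =O_+oo (fun s : R => Num.sqrt s) &
      (fun s : R => (Nminus s)%:R - main s : R) =O_+oo (fun s : R => Num.sqrt s)].
Proof.
move=> Lplus Lminus main.
have LplusE s : Lplus s = [set p | 0 < ((1 * symbol p)%:~R : R) <= s].
  by apply/funext => p; rewrite /Lplus /mkset mul1r.
have LminusE s : Lminus s = [set p | 0 < ((-1 * symbol p)%:~R : R) <= s].
  by apply/funext => p; rewrite /Lminus /mkset mulN1r opprB.
have eplus s : eigen_index [set lambda : R | 0 < lambda <= s] = Lplus s.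
  exact: eigen_indexE.
have eminus s : eigen_index [set lambda : R | - s <= lambda < 0] = Lminus s.
  rewrite eigen_indexE LminusE; apply/funext => p; rewrite /mkset mulN1r.
  by rewrite rmorphN/= oppr_gt0 lerNl andbC.
have cplus (s : R) :=
  symbol_set_count s (or_introl (conj erefl erefl) : sign_class 1 3).
have cminus (s : R) :=
  symbol_set_count s (or_intror (conj erefl erefl) : sign_class (-1) 1).
have bigO (N : R -> nat) (r : nat) : odd r ->
    (forall s, N s = 2 * size (factor_pairs r (4 * Num.truncn s + 1)))%N ->
    (fun s : R => (N s)%:R - main s : R) =O_+oo (fun s : R => Num.sqrt s).
  move=> or NE; apply/eqO_exP; exists 200 => //.
  near=> s; rewrite NE (ger0_norm (sqrtr_ge0 s)).
  by apply: factor_pairs_asymptotics => //; near: s; exact: nbhs_pinfty_ge.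
split.
- by move=> s; rewrite /Nplus /eigen_count eplus LplusE; have [] := cplus s.
- by move=> s; rewrite /Nminus /eigen_count eminus LminusE; have [] := cminus s.
- apply: (bigO _ 3%N) => // s.
  by rewrite /Nplus /eigen_count eplus LplusE; have [] := cplus s.
- apply: (bigO _ 1%N) => // s.
  by rewrite /Nminus /eigen_count eminus LminusE; have [] := cminus s.
Unshelve. all: by end_near. Qed.
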